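(* Let $\mathcal{P} \subset \mathbb{E}^n$ be a discrete point set. Then all Voronoi cells $V(p)$, $p \in \mathcal{P}$, are polyhedra if and only if $\mathcal{P}$ is locally finitely generated, i.e. the direction cone $C(p)$ is finitely generated for every $p \in \mathcal{P}$.
   Context: $\mathbb{E}^n$ is $n$-dimensional Euclidean space with Euclidean norm $\|\cdot\|$. A set $\mathcal{P} \subset \mathbb{E}^n$ is discrete if every bounded subset of $\mathbb{E}^n$ contains only finitely many points of $\mathcal{P}$. The Voronoi cell of $p \in \mathcal{P}$ relative to $\mathcal{P}$ is $V(p) := \{ x \in \mathbb{E}^n \mid \|x-p\| \le \|x-q\| \text{ for all } q \in \mathcal{P}\}$. The direction cone of $p$ is $C(p) := \operatorname{cone}(\mathcal{P}-p) = \{ \sum_{i=1}^m \lambda_i (p_i - p) \mid p_i \in \mathcal{P}, \lambda_i \ge 0, m \in \mathbb{N}\}$. A cone is finitely generated if it equals $\operatorname{cone}(v_1,\dots,v_k)$ for finitely many vectors $v_1,\dots,v_k$. $\mathcal{P}$ is called locally finitely generated if $C(p)$ is finitely generated for all $p\in\mathcal{P}$. A polyhedron is an intersection of finitely many closed half spaces of $\mathbb{E}^n$. *)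

(* Defs.v *)
From mathcomp Require Import all_boot all_order all_algebra.
From mathcomp Require Import all_classical all_reals.

Set Implicit Arguments.
Unset Strict Implicit.
Unset Printing Implicit Defensive.

Import Order.TTheory GRing.Theory Num.Theory.
Local Open Scope classical_set_scope.
Local Open Scope ring_scope.

Section EuclideanSpace.
Variables (R : realType) (n : nat).
Local Notation E := 'rV[R]_n.
Implicit Types (P C Q H A B : set E) (p x y : E).

Definition dot x y : R := \sum_(i < n) x 0 i * y 0 i.

(* The Euclidean norm; MathComp-Analysis equips 'rV[R]_n with the sup norm. *)
Definition enorm x : R := Num.sqrt (dot x x).

Definition ebounded B : Prop := exists M : R, forall x, B x -> enorm x <= M.

Definition discrete_points P : Prop :=
  forall B, ebounded B -> finite_set (P `&` B).

Definition voronoi P p : set E :=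
  [set x | forall q, P q -> enorm (x - p) <= enorm (x - q)].

(* The value m = 0 is allowed, so that cone set0 = [set 0]. *)
Definition cone A : set E :=
  [set x | exists (m : nat) (a : 'I_m -> E) (l : 'I_m -> R),
     [/\ forall i, A (a i), forall i, 0 <= l i & x = \sum_(i < m) l i *: a i]].

Definition direction_cone P p : set E := cone [set q - p | q in P].

Definition finitely_generated C : Prop :=
  exists (k : nat) (v : 'I_k -> E), C = cone (range v).

Definition locally_finitely_generated P : Prop :=
  forall p, P p -> finitely_generated (direction_cone P p).

Definition closed_half_space H : Prop :=
  exists (a : E) (b : R), a != 0 /\ H = [set x | dot a x <= b].

(* The value k = 0 is allowed: the whole space is a polyhedron. *)
Definition polyhedron Q : Prop :=
  exists (k : nat) (H : 'I_k -> set E),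
    (forall i, closed_half_space (H i)) /\ Q = \bigcap_i H i.

End EuclideanSpace.

(* Main.v *)
(** With S = P - p, the cell translated by -p is the solution set of the
    constraints 2 <s,x> <= |s|^2 for s in S.

    If cone S is finitely generated, it is generated by finitely many s_i in S,
    and by Caratheodory every s in S is a combination of the s_i with
    coefficients at most K |s|; hence the constraints of the s_i imply that of s
    as soon as |s| >= K sum_i |s_i|^2, and only finitely many s are shorter.

    Conversely, let <a_i,x> <= b_i be an irredundant description of the cell;
    b_i > 0 as 0 is an interior point.  By Farkas' lemma S lies in the cone of
    the a_i, since the cell is unbounded in each direction of the polar cone.
    Irredundancy gives a point where only the i-th constraint is active; by
    local finiteness some nonzero s in S is tight there, and it must be a
    positive multiple of a_i. *)

Require Import Defs.
From mathcomp Require Import all_boot all_order all_algebra.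
From mathcomp Require Import all_classical all_reals.
From mathcomp Require Import ring lra.

Set Implicit Arguments.
Unset Strict Implicit.
Unset Printing Implicit Defensive.

Import Order.TTheory GRing.Theory Num.Theory.
Local Open Scope classical_set_scope.
Local Open Scope ring_scope.

(** * The dot product and the Euclidean norm *)

Section Dot.
Variables (R : realType) (n : nat).
Local Notation E := 'rV[R]_n.
Implicit Types (x y z : E) (c : R).

Lemma dotC x y : dot x y = dot y x.
Proof. by apply: eq_bigr => i _; rewrite mulrC. Qed.

Lemma dotDl x y z : dot (x + y) z = dot x z + dot y z.
Proof. by rewrite -big_split; apply: eq_bigr => i _; rewrite mxE mulrDl. Qed.

Lemma dotZl c x y : dot (c *: x) y = c * dot x y.
Proof. by rewrite mulr_sumr; apply: eq_bigr => i _; rewrite mxE mulrA. Qed.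

Lemma dotNl x y : dot (- x) y = - dot x y.
Proof. by rewrite -scaleN1r dotZl mulN1r. Qed.

Lemma dotDr x y z : dot z (x + y) = dot z x + dot z y.
Proof. by rewrite dotC dotDl !(dotC z). Qed.

Lemma dotZr c x y : dot y (c *: x) = c * dot y x.
Proof. by rewrite dotC dotZl dotC. Qed.

Lemma dotNr x y : dot y (- x) = - dot y x.
Proof. by rewrite dotC dotNl dotC. Qed.

Lemma dot0l x : dot 0 x = 0.
Proof. by rewrite -(scale0r 0) dotZl mul0r. Qed.

Lemma dot_suml k (f : 'I_k -> E) y :
  dot (\sum_(i < k) f i) y = \sum_(i < k) dot (f i) y.
Proof.
exact: (big_morph (fun x => dot x y) (fun u v => dotDl u v y) (dot0l y)).
Qed.

Definition dotE := (dotDl, dotDr, dotNl, dotNr, dotZl, dotZr).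

Lemma dot_ge0 x : 0 <= dot x x.
Proof. by apply: sumr_ge0 => i _; rewrite -expr2 sqr_ge0. Qed.

Lemma dot_eq0 x : (dot x x == 0) = (x == 0).
Proof.
apply/idP/eqP => [|->]; last by rewrite dot0l.
rewrite psumr_eq0 => [/allP h|i _]; last by rewrite -expr2 sqr_ge0.
apply/rowP => i; rewrite mxE.
by have /= := h i (mem_index_enum i); rewrite mulf_eq0 orbb => /eqP.
Qed.

Lemma dot_gt0 x : (0 < dot x x) = (x != 0).
Proof. by rewrite lt_def dot_ge0 andbT dot_eq0. Qed.

Lemma enorm_ge0 x : 0 <= enorm x.
Proof. exact: sqrtr_ge0. Qed.

Lemma sqr_enorm x : enorm x ^+ 2 = dot x x.
Proof. by rewrite sqr_sqrtr // dot_ge0. Qed.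

Lemma ler_enorm x y : (enorm x <= enorm y) = (dot x x <= dot y y).
(* Squared norms suffice, so later inequalities become linear in dot products. *)
Proof. by rewrite ler_sqrt // dot_ge0. Qed.

Lemma coord_le_enorm x i : `|x 0 i| <= enorm x.
Proof.
rewrite -sqrtr_sqr; apply: ler_wsqrtr.
rewrite /dot (bigD1 i) //= -expr2 lerDl.
by apply: sumr_ge0 => j _; rewrite -expr2 sqr_ge0.
Qed.

End Dot.

(** * Convex cones, Farkas' lemma and bounded coefficients *)

Section Cones.
Variables (R : realType) (n : nat).
Local Notation E := 'rV[R]_n.
Implicit Types (A B : set E) (x y : E).

Lemma cone_incl A : A `<=` cone A.
Proof.
move=> x Ax; exists 1%N, (fun=> x), (fun=> 1); split=> //.
by rewrite big_ord1 scale1r.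
Qed.

Lemma cone_min A B :
  B 0 -> (forall x y, B x -> B y -> B (x + y)) ->
  (forall c x, 0 <= c -> B x -> B (c *: x)) -> A `<=` B -> cone A `<=` B.
Proof.
move=> B0 BD BZ AB x [m [a [l [Aa l0 ->]]]].
by apply: (big_ind B) => // i _; apply: BZ => //; apply: AB.
Qed.

Lemma cone0 A : cone A 0.
Proof.
exists 0%N, (fun=> 0), (fun=> 0); split=> //; last by rewrite big_ord0.
by case.
Qed.

Lemma coneD A x y : cone A x -> cone A y -> cone A (x + y).
Proof.
move=> [m1 [a1 [l1 [Aa1 l10 ->]]]] [m2 [a2 [l2 [Aa2 l20 ->]]]].
exists (m1 + m2)%N.
exists (fun i : 'I_(m1 + m2)%N =>
  match fintype.split i with inl j => a1 j | inr j => a2 j end).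
exists (fun i : 'I_(m1 + m2)%N =>
  match fintype.split i with inl j => l1 j | inr j => l2 j end).
split=> [i|i|]; [by case: fintype.split|by case: fintype.split|].
rewrite big_split_ord; congr (_ + _); apply: eq_bigr => i _.
  by rewrite (unsplitK (inl i : 'I_m1 + 'I_m2)).
by rewrite (unsplitK (inr i : 'I_m1 + 'I_m2)).
Qed.

Lemma coneZ A c x : 0 <= c -> cone A x -> cone A (c *: x).
Proof.
move=> c0 [m [a [l [Aa l0 ->]]]].
exists m, a, (fun i => c * l i); split=> // [i|]; first exact: mulr_ge0.
by rewrite scaler_sumr; apply: eq_bigr => i _; rewrite scalerA.
Qed.

Lemma cone_sub A B : A `<=` cone B -> cone A `<=` cone B.
Proof.
apply: cone_min; [exact: cone0|exact: coneD|exact: coneZ].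
Qed.

Lemma cone_mono A B : A `<=` B -> cone A `<=` cone B.
Proof. by move=> AB; apply: cone_sub => x /AB; apply: cone_incl. Qed.

Lemma cone_range k (v : 'I_k -> E) x :
  cone (range v) x <->
  exists2 l : 'I_k -> R, (forall i, 0 <= l i) & x = \sum_(i < k) l i *: v i.
Proof.
split=> [|[l l0 ->]]; last by exists k, v, l; split=> // i; exists i.
move: x; apply: cone_min.
- by exists (fun=> 0) => //; rewrite big1 // => i _; rewrite scale0r.
- move=> _ _ [l l0 ->] [l' l'0 ->]; exists (fun i => l i + l' i) => [i|].
    exact: addr_ge0.
  by rewrite -big_split; apply: eq_bigr => i _; rewrite scalerDl.
- move=> c _ c0 [l l0 ->]; exists (fun i => c * l i) => [i|].
    exact: mulr_ge0.
  by rewrite scaler_sumr; apply: eq_bigr => i _; rewrite scalerA.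
- move=> _ [i _ <-]; exists (fun j => (j == i)%:R) => [j|]; first exact: ler0n.
  rewrite (bigD1 i) //= eqxx scale1r big1 ?addr0 // => j /negPf ->.
  by rewrite scale0r.
Qed.

(* Bartl's induction: if the last k vectors do not suffice, as witnessed by x,
   then projecting along x onto the hyperplane orthogonal to a_0 eliminates
   a_0. *)
Lemma farkas k (a : 'I_k -> E) c :
  (forall x, (forall i, dot (a i) x <= 0) -> dot c x <= 0) ->
  cone (range a) c.
Proof.
elim: k a c => [|k IH] a c hc; apply/cone_range.
  exists (fun=> 0); first by case.
  rewrite big_ord0; apply/eqP; rewrite -dot_eq0 eq_le dot_ge0 andbT.
  by apply: hc => -[].
pose b i := a (lift ord0 i).
have [hb|/existsNP[x /not_implyP[hx /negP]]] :=
    pselect (forall x, (forall i, dot (b i) x <= 0) -> dot c x <= 0).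
  have /cone_range[l l0 ->] := IH b c hb.
  exists (fun i => oapp l 0 (unlift ord0 i)) => [i|].
    by case: unliftP => /=.
  rewrite big_ord_recl unlift_none scale0r add0r.
  by apply: eq_bigr => i _; rewrite liftK.
rewrite -ltNge => cx.
have a0x : 0 < dot (a ord0) x.
  rewrite ltNge; apply: contraTN cx => a0x; rewrite -leNgt.
  by apply: hc => i; case: (unliftP ord0 i) => [j|] -> //; exact: hx.
pose t y := dot y x / dot (a ord0) x.
(* The projection of [z] along [x] has as adjoint the map sending [y] to [y - t y *: a ord0], which
   kills [a ord0]. *)
have tE y z : dot (y - t y *: a ord0) z =
    dot y (z - (dot (a ord0) z / dot (a ord0) x) *: x).
  by rewrite !dotE /t; field; rewrite gt_eqF.
have /cone_range[l l0 lc] :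
    cone (range (fun i => b i - t (b i) *: a ord0)) (c - t c *: a ord0).
  apply: IH => y hy; rewrite tE; apply: hc => i.
  case: (unliftP ord0 i) => [j|] ->; first by rewrite -tE; exact: (hy j).
  by rewrite !dotE divfK ?gt_eqF // subrr.
(* Collecting the multiples of [a ord0] gives its coefficient [r]; it is nonnegative since [t c > 0]
   and every [t (b i) <= 0]. *)
pose r := t c - \sum_(i < k) l i * t (b i).
exists (fun i => oapp l r (unlift ord0 i)) => [i|].
  case: unliftP => //= _; rewrite subr_ge0.
  apply: (@le_trans _ _ 0); last by rewrite divr_ge0 // ltW.
  apply: sumr_le0 => j _; apply: mulr_ge0_le0 => //.
  by rewrite pmulr_lle0 ?invr_gt0.
rewrite big_ord_recl unlift_none /=.
under eq_bigr do rewrite liftK.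
rewrite -[LHS](subrK (t c *: a ord0)) lc /=.
under eq_bigr do rewrite scalerBr scalerA.
by rewrite sumrB -scaler_suml scalerBl -addrA addrC [- _ + _]addrC.
Qed.

(* Either the g_i are linearly independent and the coefficients are linear in
   the sum, or (Caratheodory) one of the g_i can be dispensed with. *)
Lemma cone_coef_bound k (g : 'I_k -> E) :
  exists2 K : R, 0 <= K & forall l : 'I_k -> R, (forall i, 0 <= l i) ->
    exists l' : 'I_k -> R,
      [/\ forall i, 0 <= l' i,
          \sum_(i < k) l' i *: g i = \sum_(i < k) l i *: g i
        & forall i, l' i <= K * enorm (\sum_(i < k) l i *: g i)].
Proof.
elim: k g => [|k IH] g; first by exists 0 => // l l0; exists l; split=> // -[].
pose G := \matrix_i g i.
have mulG (u : 'rV_k.+1) : u *m G = \sum_i u 0 i *: g i.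
  by rewrite mulmx_sum_row; apply: eq_bigr => i _; rewrite rowK.
have [freeG|] := boolP (row_free G).
  pose B := pinvmx G.
  (* [B] is a right inverse of [G], so each coefficient is an entry of [x *m B]. *)
  exists (\sum_i \sum_j `|B j i|).
    by do 2![apply: sumr_ge0 => ? _].
  move=> l l0; exists l; split=> // i; set x := \sum_(j < k.+1) l j *: g j.
  have -> : l i = (x *m B) 0 i.
    have -> : x = (\row_i l i) *m G.
      by rewrite mulG; apply: eq_bigr => j _; rewrite mxE.
    by rewrite mulmxKp // mxE.
  apply: le_trans (ler_norm _) _; rewrite mxE.
  apply: le_trans (ler_norm_sum _ _ _) _.
  rewrite mulr_suml (bigD1 i) //= -[leLHS]addr0 lerD //.
    rewrite mulr_suml; apply: ler_sum => j _.
    by rewrite normrM mulrC ler_wpM2l // coord_le_enorm.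
  by apply: sumr_ge0 => ? _; rewrite mulr_ge0 ?enorm_ge0 ?sumr_ge0.
rewrite -kermx_eq0 => /rowV0Pn[v /sub_kermxP].
rewrite mulG => vG /rV0Pn[i0 vi0].
(* A relation among the [g i], with its sign chosen to make some coefficient positive, so that the
   minimal ratio below exists. *)
have [mu [mu0 mug]] : exists mu : 'I_k.+1 -> R,
    0 < mu i0 /\ \sum_i mu i *: g i = 0.
  have [vpos|vneg|veq] := ltgtP 0 (v 0 i0).
  - by exists (v 0).
  - exists (fun i => - v 0 i); rewrite oppr_gt0; split=> //.
    by under eq_bigr do rewrite scaleNr; rewrite sumrN vG oppr0.
  - by rewrite -veq eqxx in vi0.
have /choice[K hK] : forall i : 'I_k.+1, exists K : R, 0 <= K /\
    forall l : 'I_k -> R, (forall j, 0 <= l j) -> exists l' : 'I_k -> R,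
      [/\ forall j, 0 <= l' j,
        \sum_j l' j *: g (lift i j) = \sum_j l j *: g (lift i j)
        & forall j, l' j <= K * enorm (\sum_j l j *: g (lift i j))].
  by move=> i; have [K K0 hK] := IH (g \o lift i); exists K.
have K0 i : 0 <= K i by have [] := hK i.
(* Which index is dropped depends on [l]; the sum dominates every [K i]. *)
exists (\sum_i K i) => [|l l0]; first exact: sumr_ge0.
case: (@arg_minP _ _ _ i0 (fun i => 0 < mu i) (fun i => l i / mu i) mu0).
move=> i mui imin.
(* Subtracting [t] times the relation, with [t] the least ratio, kills the coefficient at [i] and
   keeps the others nonnegative. *)
pose t := l i / mu i.
pose l1 j := l j - t * mu j.
have l1_ge0 j : 0 <= l1 j.
  rewrite subr_ge0; have [muj|muj] := ltP 0 (mu j).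
    by rewrite -ler_pdivlMr // imin.
  apply: le_trans (l0 j); apply: mulr_ge0_le0 => //.
  by rewrite divr_ge0 // ltW.
have l1i : l1 i = 0 by rewrite /l1 /t divfK ?subrr // gt_eqF.
have l1g : \sum_j l1 j *: g j = \sum_j l j *: g j.
  under eq_bigr do rewrite scalerBl -scalerA.
  by rewrite sumrB -scaler_sumr mug scaler0 subr0.
have dropi f : \sum_j f j *: g j =
    f i *: g i + \sum_(j < k) f (lift i j) *: g (lift i j).
  by rewrite (bigD1_ord i).
have [_ /(_ (l1 \o lift i)) []] := hK i; first by move=> j; apply: l1_ge0.
move=> l' [l'0 l'g l'K].
have l1E : \sum_j (l1 \o lift i) j *: g (lift i j) = \sum_j l j *: g j.
  by rewrite -l1g dropi l1i scale0r add0r.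
exists (fun j => oapp l' 0 (unlift i j)); split.
- by move=> j; case: unliftP => [j' _|_] /=; [exact: l'0|exact: lexx].
- rewrite dropi unlift_none scale0r add0r.
  by under eq_bigr do rewrite liftK; rewrite l'g l1E.
- rewrite l1E in l'K.
  move=> j; case: unliftP => [j' _|_] /=.
    apply: le_trans (l'K j') _; rewrite ler_wpM2r ?enorm_ge0 //.
    by rewrite (bigD1 i) //= lerDl sumr_ge0.
  by rewrite mulr_ge0 ?enorm_ge0 ?sumr_ge0.
Qed.

End Cones.

(** * Polyhedra as finite systems of linear inequalities *)

Section Polyhedra.
Variables (R : realType) (n : nat).
Local Notation E := 'rV[R]_n.
Implicit Types (x y z p : E) (Q S : set E).

Lemma polyhedronP Q : polyhedron Q <->
  exists (k : nat) (a : 'I_k -> E) (b : 'I_k -> R),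
    (forall i, a i != 0) /\ Q = [set x | forall i, dot (a i) x <= b i].
Proof.
split=> [[k [H [Hh ->]]]|[k [a [b [a0 ->]]]]].
  have /choice[a /choice[b hab]] : forall i, exists a b,
      a != 0 /\ H i = [set x | dot a x <= b] by exact: Hh.
  exists k, a, b; split=> [i|]; first by have [] := hab i.
  apply/seteqP; split=> x hx i.
    by have := hx i Logic.I; have [_ ->] := hab i.
  by move=> _; have [_ ->] := hab i; apply: hx.
exists k, (fun i => [set x | dot (a i) x <= b i]); split=> [i|].
  by exists (a i), (b i).
by apply/seteqP; split=> x hx i; [move=> _|]; apply: hx.
Qed.

Lemma polyhedron_preshift Q p : polyhedron Q ->
  polyhedron [set x | Q (x - p)].
Proof.
move=> /polyhedronP[k [a [b [a0 ->]]]]; apply/polyhedronP.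
exists k, a, (fun i => b i + dot (a i) p); split=> //.
by apply/seteqP; split=> x hx i; move: (hx i); rewrite !dotE lerBlDr.
Qed.

(** Zero vectors are filtered out because a closed half space has a nonzero normal. *)
Lemma polyhedron_finite (F : set E) (b : E -> R) : finite_set F ->
  polyhedron [set x | forall s, F s -> s != 0 -> dot s x <= b s].
Proof.
move=> /finite_seqP[r ->]; apply/polyhedronP.
pose r' := [seq s <- r | s != 0].
exists (size r'), (tnth (in_tuple r')), (b \o tnth (in_tuple r')); split.
  by move=> i; have := mem_tnth i (in_tuple r'); rewrite mem_filter => /andP[].
apply/seteqP; split=> x hx.
  move=> i; have := mem_tnth i (in_tuple r').
  by rewrite mem_filter => /andP[h0 hr]; apply: hx.
move=> s sr s0; have sr' : s \in in_tuple r' by rewrite mem_filter s0.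
by have /tnthP[i ->] := sr'; apply: hx.
Qed.

Lemma irredundant_system k (a : 'I_k -> E) (b : 'I_k -> R) :
  (forall i, a i != 0) ->
  exists (m : nat) (c : 'I_m -> E) (d : 'I_m -> R),
    [/\ forall i, c i != 0,
        [set x | forall i, dot (a i) x <= b i] =
          [set x | forall i, dot (c i) x <= d i]
      & forall i, exists z, d i < dot (c i) z /\
          forall j, j != i -> dot (c j) z <= d j].
Proof.
elim: k a b => [|k IH] a b a0.
  by exists 0%N, a, b; split=> // -[].
have [irr|/existsNP[i /forallNP red]] := pselect (forall i, exists z,
    b i < dot (a i) z /\ forall j, j != i -> dot (a j) z <= b j).
  by exists k.+1, a, b.
have [|m [c [d [c0 cE cirr]]]] := IH (a \o lift i) (b \o lift i).
  by move=> j; apply: a0.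
exists m, c, d; split=> //; rewrite -cE.
apply/seteqP; split=> x hx j; first exact: hx.
case: (unliftP i j) => [j'|] ->; first exact: hx.
rewrite leNgt; apply/negP => lt; apply: (red x); split=> // j' j'i.
case: (unliftP i j') j'i => [j''|] -> //; last by rewrite eqxx.
by move=> _; apply: hx.
Qed.

Lemma finite_small_step (T : eqType) (r : seq T) (u v : T -> R) :
  (forall t, t \in r -> u t < 0) ->
  exists e : R, [/\ 0 < e, e <= 1 & forall t, t \in r -> u t + e * v t <= 0].
Proof.
move=> u0.
(* Asking for all shorter steps as well lets the induction take a minimum. *)
suff [e e0 he] : exists2 e : R, 0 < e &
    forall d, 0 < d <= e -> forall t, t \in r -> u t + d * v t <= 0.
  exists (Num.min e 1); split; rewrite ?ge_min ?lexx ?orbT //.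
    by rewrite lt_min e0 ltr01.
  by apply: he; rewrite lt_min e0 ltr01 ge_min lexx.
elim: r u0 => [|t r IH] u0; first by exists 1.
have [|e e0 he] := IH; first by move=> s sr; apply: u0; rewrite inE sr orbT.
have ut : u t < 0 by apply: u0; rewrite inE eqxx.
have v1 : 0 < `|v t| + 1 by rewrite ltr_wpDl.
(* The added 1 keeps the denominator positive when [v t] vanishes. *)
exists (Num.min e (- u t / (`|v t| + 1))).
  by rewrite lt_min e0 divr_gt0 // oppr_gt0.
move=> d /andP[d0]; rewrite le_min => /andP[de].
rewrite ler_pdivlMr // => dv s; rewrite inE => /orP[/eqP ->|sr]; last first.
  by apply: he => //; rewrite d0.
have : d * v t <= d * `|v t| by rewrite ler_wpM2l ?ler_norm // ltW.
by lra.
Qed.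

End Polyhedra.

(** * Cells of locally finite sets, and their translation to Voronoi cells *)

Section Cells.
Variables (R : realType) (n : nat).
Local Notation E := 'rV[R]_n.
Implicit Types (x y d s p : E) (S P : set E).

(** The condition that [x] is at least as close to 0 as to each [s], squared and expanded. *)
Definition cell S : set E :=
  [set x | forall s, S s -> 2 * dot s x <= dot s s].

Definition locally_finite S :=
  forall M : R, finite_set (S `&` [set s | enorm s <= M]).

Lemma far_constraint s x :
  4 * dot x x <= dot s s -> 2 * dot s x <= dot s s.
Proof.
move=> h; have := dot_ge0 (s - 2 *: x).
by rewrite !dotE (dotC x s); lra.
Qed.

(** Long vectors of [S] impose nothing near [x], and the finitely many short ones leave room by
    strictness. *)
Lemma cell_step S x d : locally_finite S ->
  (forall s, S s -> s != 0 -> 2 * dot s x < dot s s) ->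
  exists e : R, [/\ 0 < e, e <= 1 & cell S (x + e *: d)].
Proof.
(* For [e <= 1], [N] is at least four times the squared norm of [x + e *: d], as [far_constraint]
   requires. *)
move=> finS hx; pose N := 8 * dot x x + 8 * dot d d.
have N0 : 0 <= N by rewrite addr_ge0 // mulr_ge0 // dot_ge0.
have /finite_seqP[r rE] := finS (Num.sqrt N).
have mem_r s : s \in r <-> S s /\ enorm s <= Num.sqrt N.
  by rewrite -[is_true _]/([set` r] s) -rE.
have [s|e [e0 e1 he]] := @finite_small_step R _ [seq s <- r | s != 0]
    (fun s => 2 * dot s x - dot s s) (fun s => 2 * dot s d).
  by rewrite mem_filter subr_lt0 => /andP[s0 /mem_r[Ss _]]; apply: hx.
exists e; split=> // s Ss.
have [->|s0] := eqVneq s 0; first by rewrite !dot0l mulr0.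
have [sN|Ns] := leP (enorm s) (Num.sqrt N).
  have := he s; rewrite mem_filter s0 => /(_ (iffRL (mem_r s) (conj Ss sN))).
  by rewrite !dotE; lra.
apply: far_constraint.
have : N <= dot s s by move: (ltW Ns); rewrite ler_sqrt // dot_ge0.
apply: le_trans; have := dot_ge0 (x - e *: d).
rewrite /N !dotE (dotC d x) => h.
have : e * (e * dot d d) <= dot d d.
  by rewrite mulrA ler_piMl ?dot_ge0 // mulr_ile1 // ltW.
by lra.
Qed.

Lemma cell_polyhedron_fg S : locally_finite S ->
  polyhedron (cell S) -> finitely_generated (cone S).
Proof.
move=> finS /polyhedronP[k [a [b [a0 cellE]]]].
have [m [c [d [c0 cE irr]]]] := irredundant_system b a0.
rewrite {}cE in cellE.
have cellP x : cell S x <-> forall i, dot (c i) x <= d i by rewrite cellE.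
have d0 i : 0 < d i.
  have [s Ss s0|e [e0 _ /cellP/(_ i)]] := cell_step (c i) finS (x := 0).
    by rewrite dotC dot0l mulr0 dot_gt0.
  rewrite add0r dotZr; apply: lt_le_trans.
  by rewrite mulr_gt0 // dot_gt0.
exists m, c; apply/seteqP; split; apply: cone_sub.
  move=> s Ss; apply: farkas => x hx; rewrite leNgt; apply/negP => sx.
  (* The scaling makes the dot product with [s] equal to [dot s s], twice what the cell allows. *)
  have /(_ s Ss) : cell S ((dot s s / dot s x) *: x).
    apply/cellP => i; apply: le_trans (ltW (d0 i)).
    by rewrite dotZr mulr_ge0_le0 // divr_ge0 ?dot_ge0 // ltW.
  rewrite dotZr divfK ?gt_eqF //.
  have : 0 < dot s s.
    by rewrite dot_gt0; apply: contraTneq sx => ->; rewrite dot0l ltxx.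
  by lra.
move=> _ [i _ <-].
have [z [cz hz]] := irr i.
have cz0 : 0 < dot (c i) z := lt_trans (d0 i) cz.
(* Shrinking [z] towards 0 makes constraint [i] tight and, as every [d j > 0], the other constraints
   strict. *)
pose t := d i / dot (c i) z.
have t0 : 0 < t by rewrite divr_gt0.
have t1 : t < 1 by rewrite ltr_pdivrMr // mul1r.
have [y yi yj] : exists2 y, dot (c i) y = d i &
    forall j, j != i -> dot (c j) y < d j.
  exists (t *: z) => [|j ji]; rewrite dotZr; first by rewrite divfK ?gt_eqF.
  apply: le_lt_trans (_ : t * d j < _); first by rewrite ler_pM2l // hz.
  by rewrite gtr_pMl.
(* y lies in the relative interior of the facet orthogonal to c_i, so some
   s in S is tight at y and must be a positive multiple of c_i. *)
have [s [Ss s0 sy]] : exists s, [/\ S s, s != 0 & dot s s <= 2 * dot s y].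
  apply: contrapT => /forallNP hs.
  (* With no tight [s], a step from [y] along [c i] would stay in the cell and yet violate
     constraint [i]. *)
  have [s Ss s0|e [e0 _ /cellP/(_ i)]] := cell_step (c i) finS (x := y).
    by rewrite ltNge; apply/negP => sy; apply: (hs s).
  rewrite dotDr yi dotZr gerDl leNgt; apply/negP/negPn.
  by rewrite mulr_gt0 // dot_gt0.
(* Farkas with one generator: if [dot (c i) x <= 0], a short step from [y] along [x] stays in the
   cell, and tightness of [s] at [y] gives [dot s x <= 0]. *)
have /cone_range[l l0] : cone (range (fun _ : 'I_1 => c i)) s.
  apply: farkas => x /(_ ord0) cx.
  have [j|e [e0 e1 he]] := @finite_small_step R _ (enum (predC1 i))
      (fun j => dot (c j) y - d j) (fun j => dot (c j) x).
    by rewrite mem_enum subr_lt0; apply: yj.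
  have /(_ s Ss) : cell S (y + e *: x).
    apply/cellP => j; rewrite !dotE.
    have [->|ji] := eqVneq j i.
      by rewrite yi gerDl mulr_ge0_le0 // ltW.
    by have := he j; rewrite mem_enum => /(_ ji); lra.
  rewrite !dotE => h.
  by rewrite -(pmulr_rle0 _ e0); lra.
rewrite big_ord1 => sE.
have lN0 : l ord0 != 0.
  by apply: contraNneq s0 => l00; rewrite sE l00 scale0r.
have -> : c i = (l ord0)^-1 *: s by rewrite sE scalerK.
by apply: coneZ; [rewrite invr_ge0|exact: cone_incl].
Qed.

Lemma cone_finite_support S x : cone S x ->
  exists T : set E, [/\ finite_set T, T `<=` S & cone T x].
Proof.
move=> [m [a [l [Sa l0 ->]]]]; exists (range a); split.
- exact: finite_image.
- by move=> _ [i _ <-].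
- by apply/cone_range; exists l.
Qed.

Lemma cell_fg_polyhedron S : locally_finite S ->
  finitely_generated (cone S) -> polyhedron (cell S).
Proof.
move=> finS [k [v coneE]].
(* The generators [v j] need not lie in [S]; each is replaced by finitely many points of [S] whose
   cone contains it. *)
have /choice[T hT] : forall j, exists T : set E,
    [/\ finite_set T, T `<=` S & cone T (v j)].
  move=> j; apply: cone_finite_support; rewrite coneE.
  by apply: cone_incl; exists j.
pose U := \bigcup_j T j.
have finU : finite_set U.
  by apply: bigcup_finite => // j _; have [] := hT j.
have US : U `<=` S by move=> s [j _]; have [_ + _] := hT j; apply.
have SU : S `<=` cone U.
  move=> s /cone_incl; rewrite coneE; apply: cone_sub => _ [j _ <-].
  by have [_ _] := hT j; apply: cone_mono => u Tu; exists j.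
have /finite_seqP[r rE] := finU.
pose g := tnth (in_tuple r).
have Ug i : U (g i) by rewrite rE; apply: mem_tnth.
have gU : U `<=` range g.
  move=> u; rewrite rE => ur.
  by have /tnthP[i ->] : u \in in_tuple r := ur; exists i.
have [K K0 hK] := cone_coef_bound g.
pose M := K * \sum_i dot (g i) (g i).
have finF : finite_set (U `|` (S `&` [set s | enorm s <= M])).
  by rewrite finite_setU; split.
suff -> : cell S = [set x | forall s,
    (U `|` (S `&` [set s | enorm s <= M])) s -> s != 0 ->
    dot s x <= dot s s / 2] by apply: polyhedron_finite.
apply/seteqP; split=> x hx s.
  move=> Fs _; have /hx : S s by case: Fs => [/US|[]].
  by lra.
have [->|s0] := eqVneq s 0; first by rewrite !dot0l mulr0.
move=> Ss; have [sM|Ms] := leP (enorm s) M.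
  by have : dot s x <= dot s s / 2 by [apply: hx => //; right]; lra.
have /cone_range[l0 /hK[l [l_ge0 lE lK]] sE] := cone_mono gU (SU s Ss).
rewrite -sE in lE lK.
(* Summing the constraints of the [g i] with weights [l i <= K * enorm s] bounds [2 * dot s x] by
   [enorm s * M]. *)
apply: (@le_trans _ _ (enorm s * M)); last first.
  by rewrite -sqr_enorm expr2 ler_wpM2l ?enorm_ge0 // ltW.
have -> : enorm s * M = \sum_i K * enorm s * dot (g i) (g i).
  by rewrite -mulr_sumr mulrCA mulrA.
rewrite -[in leLHS]lE dot_suml mulr_sumr; apply: ler_sum => i _.
rewrite dotZl mulrCA; apply: le_trans (_ : l i * dot (g i) (g i) <= _).
  rewrite ler_wpM2l //.
  have [->|g0] := eqVneq (g i) 0; first by rewrite !dot0l mulr0.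
  by have := hx (g i) (or_introl (Ug i)) g0; lra.
by rewrite ler_wpM2r ?dot_ge0.
Qed.

Lemma voronoiE P p :
  voronoi P p = [set x | cell [set q - p | q in P] (x - p)].
Proof.
have key q x : (enorm (x - p) <= enorm (x - q)) =
    (2 * dot (q - p) (x - p) <= dot (q - p) (q - p)).
  rewrite ler_enorm !dotE (dotC p x) (dotC q x) (dotC q p).
  by apply/idP/idP; lra.
apply/seteqP; split=> x hx.
  by move=> _ [q Pq <-]; rewrite -key; apply: hx.
by move=> q Pq; rewrite key; apply: hx; exists q.
Qed.

Lemma discrete_translate P p : discrete_points P ->
  locally_finite [set q - p | q in P].
Proof.
move=> dP M.
pose B := [set q | enorm (q - p) <= M].
have bB : ebounded B.
  (* From the bound of the squared norm of [q] by twice those of [q - p] and [p] together. *)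
  exists (Num.sqrt (2 * M ^+ 2 + 2 * dot p p)) => q Bq.
  apply: ler_wsqrtr.
  have : dot (q - p) (q - p) <= M ^+ 2.
    rewrite -sqr_enorm lerXn2r ?nnegrE ?enorm_ge0 //.
    exact: le_trans (enorm_ge0 (q - p)) Bq.
  have := dot_ge0 (q - 2 *: p).
  by rewrite !dotE (dotC p q); lra.
apply: sub_finite_set (finite_image (fun q => q - p) (dP B bB)).
by move=> _ [[q Pq <-] qM]; exists q.
Qed.

Lemma polyhedron_voronoi P p : discrete_points P ->
  polyhedron (voronoi P p) <-> finitely_generated (direction_cone P p).
Proof.
move=> /(discrete_translate p) finS; rewrite voronoiE; split=> [Vp|Cp].
  apply: cell_polyhedron_fg => //.
  (* Shifting by [- p] undoes the translation in [voronoiE]. *)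
  have := polyhedron_preshift (- p) Vp; congr polyhedron.
  by apply/seteqP; split=> x; rewrite /= opprK addrK.
exact/polyhedron_preshift/cell_fg_polyhedron.
Qed.

End Cells.

Theorem theorem4p5 (R : realType) (n : nat) (P : set 'rV[R]_n)
  (hP : discrete_points P) :
  (forall p : 'rV[R]_n, P p -> polyhedron (voronoi P p)) <->
  locally_finitely_generated P.
Proof.
by split=> h p Pp; apply/(polyhedron_voronoi p hP); apply: h.
Qed.
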